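(* Assume that the initial restricted master problem $IBBE$ is feasible and that each pricing problem is solved by a method returning an optimal vertex of its feasible set. Then the column generation algorithm for $IBME$ described in the context terminates after a finite number of iterations, and upon termination the optimal solution of the current restricted master problem is an optimal solution of $IBME$.
   Context: Data: finite sets $N$ (zones), $CNE$ (critical network elements), $RDB$ (reserve demand bids), $G$ (generators); locations $z(r)\in N$ for $r\in RDB$ and $z(g)\in N$ for $g\in G$; real parameters $VR^r$, $DR_r$ ($r\in RDB$), $\widetilde P_g$ ($g\in G$), $PTDF_{k,z}$, $\widetilde F_k$ ($k\in CNE$, $z\in N$). For $l\in N$ let $V^l=\{v\in\mathbb{R}^N: v_l=-1,\ v_z\ge0\ \forall z\ne l,\ \sum_{z}v_z=0\}$. $IBME$ is the problem of maximizing $\sum_r VR^r dr_r$ over real variables $dr,pr,nr$ and a family $f=(f_{v^l})_{l\in N,v^l\in V^l}$ with finitely many non-zero elements, subject to $dr_r\le DR_r$ $(r\in RDB)$ [dual $sdr_r$]; $pr_g\le\widetilde P_g$ $(g\in G)$ [dual $s^+_g$]; $\sum_{r:z(r)=z}dr_r-\sum_{g:z(g)=z}pr_g=-nr_z$ $(z\in N)$ [dual $\pi r_z$]; $nr_z=\sum_{l}\sum_{v^l\in V^l}v^l_z f_{v^l}$ $(z\in N)$ [dual $\pi rnet_z$]; $\sum_l\sum_{v^l\in V^l}\max(0,\sum_zPTDF_{k,z}v^l_z)f_{v^l}\le\widetilde F_k$ $(k\in CNE)$ [dual $SP_k$]; $dr,pr,f\ge0$. For finite subsets $C^l\subset V^l$,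 the restricted master problem (RMP) is the linear program obtained by keeping only the variables $f_{v^l}$ with $v^l\in C^l$. Its dual is: minimize $\sum_rDR_r\,sdr_r+\sum_g\widetilde P_g s^+_g+\sum_k\widetilde F_kSP_k$ subject to $s^+_g-\pi r_{z(g)}\ge0$ for all $g\in G$; $sdr_r+\pi r_{z(r)}\ge VR^r$ for all $r\in RDB$; $\pi r_z+\pi rnet_z=0$ for all $z\in N$; $-\sum_z\pi rnet_zv^l_z+\sum_kSP_k\max(0,\sum_zPTDF_{k,z}v^l_z)\ge0$ for all $l\in N$, $v^l\in C^l$; $s^+,sdr,SP\ge0$. The initial RMP is $IBBE$: $C^l=\{e_n-e_l: n\in N, n\ne l\}$, where $e_j$ is the $j$-th unit vector of $\mathbb{R}^N$ (bilateral exchanges). Pricing problem for $l\in N$, given dual values $(\pi rnet,SP)$: minimize $-\sum_z\pi rnet_zv_z+\sum_kSP_kt_k$ over $(v,t)\in\mathbb{R}^N\times\mathbb{R}^{CNE}$ subject to $t_k\ge\sum_zPTDF_{k,z}v_z$ and $t_k\ge0$ for all $k\in CNE$, $v_l=-1$, $\sum_zv_z=0$, $v_z\ge0$ for all $z\ne l$. Algorithm: starting from the initial RMP, repeat: solve the current RMP to obtain optimal primal and dual solutions; solve the pricing problem for each $l\in N$ with the obtained dual values; if at least one pricing problem has a negative optimal value, add the corresponding optimal vector(s) $v$ (for each $l$ with negative value) to $C^l$, together with the decision variable(s) $f_v$; otherwise terminate and return the current RMP solution. *)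

(* Defs.v *)
From HB Require Import structures.
From mathcomp Require Import all_boot all_order all_algebra finmap.
From mathcomp Require Import reals.

Set Implicit Arguments.
Unset Strict Implicit.
Unset Printing Implicit Defensive.

Import Order.TTheory GRing.Theory Num.Theory.

Local Open Scope fset_scope.
Local Open Scope ring_scope.

Record market (R : realType) := Market {
  zone : finType;
  cne : finType;
  rdb : finType;
  gen : finType;
  rdb_zone : rdb -> zone;
  gen_zone : gen -> zone;
  VR : rdb -> R;
  DR : rdb -> R;
  Pmax : gen -> R;            (* \widetilde P *)
  PTDF : cne -> zone -> R;
  Fmax : cne -> R             (* \widetilde F *)
}.

Section ColumnGeneration.
Variables (R : realType) (M : market R).

Definition vec := {ffun zone M -> R}.

Definition exchange_set (l : zone M) (v : vec) : Prop :=
  [/\ v l = -1, forall z, z != l -> 0 <= v z & \sum_z v z = 0].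

Definition flow (k : cne M) (v : vec) : R := \sum_z PTDF k z * v z.

(* In the restricted problems, the variables [fx l v] that are absent are
   represented by the value 0. *)
Record primal_sol := Primal {
  dr : {ffun rdb M -> R};
  pr : {ffun gen M -> R};
  nr : {ffun zone M -> R};
  fx : zone M -> {fsfun vec -> R with 0}
}.

Definition primal_objective (x : primal_sol) : R := \sum_r VR r * dr x r.

(* The constraints of IBME when [fx l v] is a variable exactly for the pairs
   (l, v) such that [A l v]. *)
Record master_feasible (A : zone M -> vec -> Prop) (x : primal_sol) : Prop := {
  fx_supp : forall l (v : vec), v \in finsupp (fx x l) -> A l v;
  dr_le : forall r, dr x r <= DR r;
  pr_le : forall g, pr x g <= Pmax g;
  balance : forall z, \sum_(r | rdb_zone r == z) dr x r
                      - \sum_(g | gen_zone g == z) pr x g = - nr x z;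
  netting : forall z,
    nr x z = \sum_l \sum_(v <- finsupp (fx x l)) v z * fx x l v;
  capacity : forall k,
    \sum_l \sum_(v <- finsupp (fx x l)) Num.max 0 (flow k v) * fx x l v
      <= Fmax k;
  dr_ge0 : forall r, 0 <= dr x r;
  pr_ge0 : forall g, 0 <= pr x g;
  fx_ge0 : forall l (v : vec), 0 <= fx x l v
}.

Definition master_optimal (A : zone M -> vec -> Prop) (x : primal_sol) : Prop :=
  master_feasible A x /\
  forall x', master_feasible A x' -> primal_objective x' <= primal_objective x.

Definition ibme_optimal : primal_sol -> Prop := master_optimal exchange_set.

Definition columns := zone M -> {fset vec}.

Definition rmp_feasible (C : columns) : primal_sol -> Prop :=
  master_feasible (fun l v => v \in C l).

Definition rmp_optimal (C : columns) : primal_sol -> Prop :=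
  master_optimal (fun l v => v \in C l).

Definition unit_vec (j : zone M) : vec := [ffun z => (z == j)%:R].

Definition ibbe : columns :=
  fun l => [fset unit_vec n - unit_vec l | n in [pred n : zone M | n != l]].

Record dual_sol := Dual {
  sdr : {ffun rdb M -> R};
  splus : {ffun gen M -> R};
  pir : {ffun zone M -> R};
  pirnet : {ffun zone M -> R};
  SP : {ffun cne M -> R}
}.

Definition dual_objective (y : dual_sol) : R :=
  \sum_r DR r * sdr y r + \sum_g Pmax g * splus y g + \sum_k Fmax k * SP y k.

Record dual_feasible (C : columns) (y : dual_sol) : Prop := {
  dual_pr : forall g, 0 <= splus y g - pir y (gen_zone g);
  dual_dr : forall r, VR r <= sdr y r + pir y (rdb_zone r);
  dual_nr : forall z, pir y z + pirnet y z = 0;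
  dual_fx : forall l (v : vec), v \in C l ->
    0 <= - \sum_z pirnet y z * v z + \sum_k SP y k * Num.max 0 (flow k v);
  splus_ge0 : forall g, 0 <= splus y g;
  sdr_ge0 : forall r, 0 <= sdr y r;
  SP_ge0 : forall k, 0 <= SP y k
}.

Definition dual_optimal (C : columns) (y : dual_sol) : Prop :=
  dual_feasible C y /\
  forall y', dual_feasible C y' -> dual_objective y <= dual_objective y'.

(* The pair (v, t). *)
Definition pricing_point := (vec * {ffun cne M -> R})%type.

(* The constraints on v alone are exactly those defining V^l. *)
Definition pricing_feasible (l : zone M) (p : pricing_point) : Prop :=
  [/\ forall k, flow k p.1 <= p.2 k, forall k, 0 <= p.2 k
    & exchange_set l p.1].

Definition pricing_objective (pn : {ffun zone M -> R}) (sp : {ffun cne M -> R})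
    (p : pricing_point) : R :=
  - \sum_z pn z * p.1 z + \sum_k sp k * p.2 k.

Definition pricing_optimal (l : zone M) (pn : {ffun zone M -> R})
    (sp : {ffun cne M -> R}) (p : pricing_point) : Prop :=
  pricing_feasible l p /\
  forall p', pricing_feasible l p' ->
    pricing_objective pn sp p <= pricing_objective pn sp p'.

(* Vertices of the polyhedron of the pricing problem, as its extreme points. *)
Definition pricing_vertex (l : zone M) (p : pricing_point) : Prop :=
  pricing_feasible l p /\
  forall (a b : pricing_point) (s : R),
    pricing_feasible l a -> pricing_feasible l b -> 0 < s < 1 ->
    (forall z, p.1 z = s * a.1 z + (1 - s) * b.1 z) ->
    (forall k, p.2 k = s * a.2 k + (1 - s) * b.2 k) ->
    a = b.

(* [price l pn sp p]: given the dual values (pn, sp), the method may return the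
   point p for the pricing problem of l. *)
Definition pricing_method :=
  zone M -> {ffun zone M -> R} -> {ffun cne M -> R} -> pricing_point -> Prop.

(* A pricing problem without optimal solution (it is infeasible when there is
   a single zone) need not get an answer. *)
Definition returns_optimal_vertex (price : pricing_method) : Prop :=
  forall l pn sp,
    ((exists p, pricing_optimal l pn sp p) -> exists p, price l pn sp p) /\
    (forall p, price l pn sp p ->
       pricing_optimal l pn sp p /\ pricing_vertex l p).

Definition negative_price (y : dual_sol) (l : zone M) : Prop :=
  exists p, pricing_optimal l (pirnet y) (SP y) p /\
            pricing_objective (pirnet y) (SP y) p < 0.

Definition rmp_solved (C : columns) (x : primal_sol) (y : dual_sol) : Prop :=
  rmp_optimal C x /\ dual_optimal C y.

Definition stops (y : dual_sol) : Prop := forall l, ~ negative_price y l.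

Definition adds_columns (price : pricing_method) (y : dual_sol) (C C' : columns) :
    Prop :=
  (exists l, negative_price y l) /\
  forall l,
    (negative_price y l ->
       exists p, price l (pirnet y) (SP y) p /\ C' l = p.1 |` C l) /\
    (~ negative_price y l -> C' l = C l).

Definition next_rmp (price : pricing_method) (C C' : columns) : Prop :=
  exists x y, rmp_solved C x y /\ adds_columns price y C C'.

Definition returned (C : columns) (x : primal_sol) : Prop :=
  exists y, rmp_solved C x y /\ stops y.

(* The column families that can occur in a run of the algorithm. *)
Inductive reached (price : pricing_method) : columns -> Prop :=
| reached_init : reached price ibbe
| reached_next C C' : reached price C -> next_rmp price C C' -> reached price C'.

End ColumnGeneration.

Arguments ibbe {R} M l.

(* Main.v *)
Require Import Defs.
From mathcomp Require Import all_boot all_order all_algebra finmap.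
From mathcomp Require Import reals boolp lra.

Set Implicit Arguments.
Unset Strict Implicit.
Unset Printing Implicit Defensive.

Import Order.TTheory GRing.Theory Num.Theory.

(** Column generation is correct because of two facts about linear programs.

    Optimality is linear programming duality.  A restricted master problem is
    feasible, since it contains the initial columns, and bounded, since each
    demand [dr r] lies between 0 and [DR r]; so it and its dual attain a common
    optimal value ([rmp_strong_duality]).  A pricing problem, if feasible, also
    attains its minimum ([pricing_attained]), and its value at an exchange [v],
    taken with the cheapest [t], is the left-hand side of the dual constraint
    of the column [v].  Hence, if no pricing problem has a negative optimal
    value, the dual solution at hand satisfies the constraints of all the
    exchanges ([stops_dual_feasible]).  A feasible point of the full problem
    has finite support, so it is a feasible point of the restricted problem on
    that support, and weak duality there bounds its objective by the dual
    objective, which the current primal solution attains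
    ([returned_optimal]).

    Termination is the finiteness of the set of vertices.  A vertex of a pricing
    polyhedron is determined by its set of tight constraints
    ([vertex_determined]).  Every iteration adds, for some zone, a vertex whose
    exchange is not yet a column, as the columns present have a nonnegative
    price ([new_column]).  By the pigeonhole principle two iterations of an
    infinite run would add the same vertex for the same zone, which the earlier
    of the two had already made a column ([no_infinite_run]).

    Duality itself comes from Fourier-Motzkin elimination
    ([fourier_motzkin]). *)

(** * Linear programming duality *)

Section LP.
Local Open Scope ring_scope.
Variable R : realFieldType.

Lemma separating_value (I : finType) (N P : pred I) (lo hi : I -> R) :
  (forall n p, N n -> P p -> lo n <= hi p) ->
  exists c, (forall n, N n -> lo n <= c) /\ (forall p, P p -> c <= hi p).
Proof.
move=> lohi; case: (pickP N) => [n0 Nn0|N0].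
  case: (arg_maxP lo Nn0) => m Nm mmax.
  by exists (lo m); split=> [n /mmax|p Pp] //; apply: lohi.
case: (pickP P) => [p0 Pp0|P0].
  case: (arg_minP hi Pp0) => m Pm mmin.
  by exists (hi m); split=> [n|p /mmin] //; rewrite N0.
by exists 0; split=> [n|p]; rewrite ?N0 ?P0.
Qed.

(** The pair of weights with which elimination adds the rows [e.1] and [e.2] of a
    system whose eliminated column is [a]: a row with zero coefficient is kept,
    two rows with opposite signs are combined so as to cancel, and every other
    pair yields the trivial inequality. *)
Definition combine (I : finType) (a : I -> R) (e : I * I) : R * R :=
  if a e.1 == 0 then (1, 0)
  else if (0 < a e.1) && (a e.2 < 0) then (- a e.2, a e.1) else (0, 0).

Lemma combine_ge0 (I : finType) (a : I -> R) e :
  (0 <= (combine a e).1) /\ (0 <= (combine a e).2).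
Proof.
rewrite /combine; case: eqP => _ /=; first by rewrite ler01.
by case: ifP => [/andP[p n]|_] //=; split; lra.
Qed.

Lemma combine_cancel (I : finType) (a : I -> R) e :
  (combine a e).1 * a e.1 + (combine a e).2 * a e.2 = 0.
Proof.
rewrite /combine; case: eqP => [->|_] /=; first by rewrite mul0r mulr0 addr0.
by case: ifP => _ /=; rewrite ?mul0r ?addr0 // mulrC mulrN addNr.
Qed.

Lemma sum_delta (I : finType) (p : I) (g : I -> R) :
  \sum_i (i == p)%:R * g i = g p.
Proof.
rewrite (bigD1 p) //= eqxx mul1r big1 ?addr0 // => i /negbTE->.
by rewrite mul0r.
Qed.

Lemma sum_combine (I : finType) (p n : I) (u w : R) (g : I -> R) :
  \sum_i (u * (i == p)%:R + w * (i == n)%:R) * g i = u * g p + w * g n.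
Proof.
under eq_bigr do rewrite mulrDl -!mulrA.
by rewrite big_split /= -!mulr_sumr !sum_delta.
Qed.

(** A solution of the combined system leaves room for the eliminated variable:
    the combinations of rows with opposite signs say that each lower bound on
    it is at most each upper bound. *)
Lemma eliminate_variable (I J : finType) (A : I -> J -> R) (b : I -> R) (j0 : J)
    (x : J -> R) :
  (forall e : I * I,
     let: (u, w) := combine (A^~ j0) e in
     \sum_j (u * A e.1 j + w * A e.2 j) * x j <= u * b e.1 + w * b e.2) ->
  exists x', forall i, \sum_j A i j * x' j <= b i.
Proof.
move=> Ax; pose a := A^~ j0; pose r i := b i - \sum_(j | j != j0) A i j * x j.
have r_ge0 e : 0 <= (combine a e).1 * r e.1 + (combine a e).2 * r e.2.
  have := Ax e; have := combine_cancel a e.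
  rewrite /a; case: (combine _ e) => u w /= c0.
  rewrite (bigD1 j0) //= c0 mul0r add0r.
  under eq_bigr do rewrite mulrDl -!mulrA.
  rewrite big_split /= -!mulr_sumr /r; lra.
have [c [cn cp]] : exists c, (forall n, a n < 0 -> r n / a n <= c) /\
    (forall p, 0 < a p -> c <= r p / a p).
  apply: (@separating_value _ (fun n => a n < 0) (fun p => 0 < a p)) => n p an ap.
  have := r_ge0 (p, n); rewrite /combine /= (gt_eqF ap) ap an /=.
  rewrite ler_pdivlMr // mulrAC ler_ndivrMr //; lra.
exists (fun j => if j == j0 then c else x j) => i.
rewrite (bigD1 j0) //= eqxx.
under eq_bigr => j /negbTE-> do [].
rewrite -lerBrDr -/(r i) -/(a i).
case: (ltrgtP (a i) 0) => [ai|ai|ai].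
- by have := cn _ ai; rewrite ler_ndivrMr // mulrC.
- by have := cp _ ai; rewrite ler_pdivlMr // mulrC.
- have := r_ge0 (i, i); rewrite /combine /= ai eqxx /=; lra.
Qed.

(** Eliminating all the variables leaves finitely many nonnegative combinations
    [w k] of the rows of [A], each of them vanishing on the columns, which
    decide solvability for all right-hand sides at once.  This uniformity in
    [b] is what gives optimal solutions, and not only a Farkas certificate, in
    [lp_duality]. *)
Lemma fourier_motzkin (I J : finType) (A : I -> J -> R) :
  exists (K : finType) (w : K -> I -> R),
  [/\ forall k i, 0 <= w k i,
      forall k j, \sum_i w k i * A i j = 0
    & forall b : I -> R, (forall k, 0 <= \sum_i w k i * b i) ->
        exists x, forall i, \sum_j A i j * x j <= b i].
Proof.
have [n] := ubnP #|[set j | [exists i, A i j != 0]]|.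
elim: n I A => // n IHn I A.
case: (pickP (fun j => [exists i, A i j != 0])) => [j0 Aj0|A0] cardA.
  pose u e := (combine (A^~ j0) e).1; pose v e := (combine (A^~ j0) e).2.
  pose m e i := u e * (i == e.1)%:R + v e * (i == e.2)%:R.
  pose A' e j := u e * A e.1 j + v e * A e.2 j.
  have [|K [w [w_ge0 wA w_sol]]] := IHn (I * I)%type A'.
    move: cardA; rewrite ltnS => /(leq_trans _); apply.
    apply: proper_card; apply/properP; split; last first.
      exists j0; rewrite !inE //; apply/existsPn => e.
      by rewrite negbK /A' combine_cancel.
    apply/subsetP => j; rewrite !inE => /existsP[e]; apply: contraR.
    by move/existsPn=> Aj; rewrite /A' !(eqP (negPn (Aj _))) !mulr0 addr0.
  have sum_w k (g : I -> R) : \sum_i (\sum_e w k e * m e i) * g i =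
      \sum_e w k e * (u e * g e.1 + v e * g e.2).
    under eq_bigr do rewrite mulr_suml.
    rewrite exchange_big; apply: eq_bigr => e _.
    by under eq_bigr do rewrite -mulrA; rewrite -mulr_sumr sum_combine.
  exists K, (fun k i => \sum_e w k e * m e i); split=> [k i|k j|b].
  - apply: sumr_ge0 => e _; apply: mulr_ge0 => //.
    by have [? ?] := combine_ge0 (A^~ j0) e; rewrite addr_ge0 ?mulr_ge0.
  - by rewrite sum_w -[RHS](wA k j).
  - move=> wb; have [|x xP] := w_sol (fun e => u e * b e.1 + v e * b e.2).
      by move=> k; rewrite -sum_w.
    apply: (@eliminate_variable _ _ _ _ j0 x) => e.
    by have := xP e; rewrite /A' /u /v; case: (combine _ e).
exists I, (fun k i => (i == k)%:R); split=> [k i|k j|b b_ge0].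
- exact: ler0n.
- by rewrite sum_delta; have /existsPn/(_ k)/negPn/eqP := negbT (A0 j).
- exists (fun=> 0) => i; rewrite big1 => [|j _]; last by rewrite mulr0.
  by have := b_ge0 i; rewrite sum_delta.
Qed.

Lemma big_option (I : finType) (F : option I -> R) :
  \sum_o F o = F None + \sum_i F (Some i).
Proof.
rewrite (bigD1 None) //=; congr (_ + _).
rewrite (reindex_omap Some id) /=; last by case.
by apply: eq_bigl => i; rewrite eqxx.
Qed.

(** The system of the inequalities A x <= b and c x >= g is solvable exactly when
    w_None * g <= sum_i w_i * b_i for each of the finitely many combinations
    [w] given by elimination.  The largest such [g] is therefore attained, and
    a combination that limits it is, after scaling, an optimal dual
    solution. *)
Theorem lp_duality (I J : finType) (A : I -> J -> R) (b : I -> R) (c : J -> R) :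
  (exists x, forall i, \sum_j A i j * x j <= b i) ->
  (exists B, forall x, (forall i, \sum_j A i j * x j <= b i) ->
     \sum_j c j * x j <= B) ->
  exists (x : J -> R) (y : I -> R),
  [/\ forall i, \sum_j A i j * x j <= b i, forall i, 0 <= y i,
      forall j, \sum_i y i * A i j = c j
    & \sum_i y i * b i <= \sum_j c j * x j].
Proof.
move=> [x0 x0P] [B Bc].
pose A' o j := if o is Some i then A i j else - c j.
have [K [w [w_ge0 wA w_sol]]] := fourier_motzkin A'.
pose b' g o := if o is Some i then b i else - g.
pose wb k := \sum_i w k (Some i) * b i.
have solvable g : (forall k, w k None * g <= wb k) ->
    exists x, (forall i, \sum_j A i j * x j <= b i) /\ g <= \sum_j c j * x j.
  move=> gP; have [k|x xP] := w_sol (b' g).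
    by rewrite big_option /= -/(wb k); have := gP k; lra.
  exists x; split=> [i|]; first exact: (xP (Some i)).
  have := xP None; rewrite /= (eq_bigr (fun j => - (c j * x j))) ?sumrN ?lerN2 //.
  by move=> j _; rewrite mulNr.
have wbP k : w k None * \sum_j c j * x0 j <= wb k.
  have -> : w k None * \sum_j c j * x0 j =
      \sum_i w k (Some i) * \sum_j A i j * x0 j.
    rewrite mulr_sumr; under [RHS]eq_bigr do rewrite mulr_sumr.
    rewrite exchange_big; apply: eq_bigr => j _ /=.
    rewrite mulrA (eq_bigr _ (fun i _ => mulrA _ _ _)) -mulr_suml.
    by have := wA k j; rewrite big_option /= mulrN addrC => /subr0_eq ->.
  by apply: ler_sum => i _; apply: ler_wpM2l.
case: (pickP (fun k => 0 < w k None)) => [k0 wk0|w0]; last first.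
  (* If no combination involves the objective row, every objective value
     is reached or exceeded, against the bound B. *)
  have [k|x [xP]] := solvable (Num.max (B + 1) (\sum_j c j * x0 j)).
    have wk : w k None = 0 by apply/eqP; rewrite eq_le w_ge0 leNgt (negbT (w0 k)).
    by have := wbP k; rewrite wk !mul0r.
  by rewrite ge_max => /andP[h _]; have := Bc x xP; lra.
case: (@arg_minP _ _ K k0 (fun k => 0 < w k None)
  (fun k => wb k / w k None) wk0) => k wk kmin.
have [k'|x [xP x_ge]] := solvable (wb k / w k None).
  have := w_ge0 k' None; rewrite le_eqVlt => /orP[/eqP w0|w_gt0].
    by have := wbP k'; rewrite -w0 !mul0r.
  by have := kmin _ w_gt0; rewrite ler_pdivlMr // mulrC.
exists x, (fun i => w k (Some i) / w k None); split=> [//|i|j|].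
- by rewrite divr_ge0.
- under eq_bigr do rewrite mulrAC.
  rewrite -mulr_suml; have := wA k j; rewrite big_option /= mulrN addrC.
  by move/subr0_eq ->; rewrite mulrAC divff ?mul1r ?gt_eqF.
- by rewrite (eq_bigr _ (fun i _ => mulrAC _ _ _)) -mulr_suml.
Qed.

Section MixedForm.
Variables (I E J : finType) (A : I -> J -> R) (b : I -> R).
Variables (D : E -> J -> R) (d : E -> R) (c : J -> R).

(** The program in the form: x >= 0, A x <= b, D x = d, maximize c x. *)
Definition lp_feasible (x : J -> R) : Prop :=
  [/\ forall j, 0 <= x j, forall i, \sum_j A i j * x j <= b i
    & forall e, \sum_j D e j * x j = d e].

Definition lp_dual_feasible (y : I -> R) (u : E -> R) : Prop :=
  (forall i, 0 <= y i) /\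
  forall j, c j <= \sum_i y i * A i j + \sum_e u e * D e j.

Lemma lp_weak_duality x y u :
  lp_feasible x -> lp_dual_feasible y u ->
  \sum_j c j * x j <= \sum_i y i * b i + \sum_e u e * d e.
Proof.
move=> [x_ge0 Ax Dx] [y_ge0 yA].
have swap (K : finType) (B : K -> J -> R) (w : K -> R) :
    \sum_k w k * \sum_j B k j * x j = \sum_j (\sum_k w k * B k j) * x j.
  under eq_bigr do rewrite mulr_sumr.
  rewrite exchange_big; apply: eq_bigr => j _; rewrite mulr_suml.
  by apply: eq_bigr => k _; rewrite mulrA.
apply: le_trans (_ : _ <= \sum_i y i * \sum_j A i j * x j
                         + \sum_e u e * \sum_j D e j * x j) _.
  rewrite !swap -big_split /=; apply: ler_sum => j _.
  by rewrite -mulrDl; apply: ler_wpM2r.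
apply: lerD; last by under eq_bigr do rewrite Dx.
by apply: ler_sum => i _; apply: ler_wpM2l.
Qed.

(** Reduction to [lp_duality]: an equality is a pair of opposite inequalities,
    whose two multipliers are subtracted, and the multipliers of the sign
    constraints become the slacks in the dual inequalities. *)
Theorem lp_strong_duality :
  (exists x, lp_feasible x) ->
  (exists B, forall x, lp_feasible x -> \sum_j c j * x j <= B) ->
  exists x y u, [/\ lp_feasible x, lp_dual_feasible y u
    & \sum_i y i * b i + \sum_e u e * d e <= \sum_j c j * x j].
Proof.
move=> [x0 x0P] [B Bc].
pose A' (s : (I + J) + (E + E)) j := match s with
  | inl (inl i) => A i j | inl (inr j') => - (j == j')%:R
  | inr (inl e) => D e j | inr (inr e) => - D e j end.
pose b' (s : (I + J) + (E + E)) := match s with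
  | inl (inl i) => b i | inl (inr j') => 0
  | inr (inl e) => d e | inr (inr e) => - d e end.
have sumN (G : J -> R) x : \sum_j - G j * x j = - \sum_j G j * x j.
  by rewrite -sumrN; apply: eq_bigr => j _; rewrite mulNr.
have feasibleP x : lp_feasible x <-> forall s, \sum_j A' s j * x j <= b' s.
  split=> [[x_ge0 Ax Dx] [[i|j]|[e|e]]|xP] /=.
  - exact: Ax.
  - by rewrite sumN sum_delta oppr_le0.
  - by rewrite Dx.
  - by rewrite sumN Dx.
  split=> [j|i|e].
  - by have := xP (inl (inr j)); rewrite /= sumN sum_delta oppr_le0.
  - exact: (xP (inl (inl i))).
  - apply/eqP; rewrite eq_le (xP (inr (inl e))) /=.
    by have := xP (inr (inr e)); rewrite /= sumN lerN2.
have [||x [y [xP y_ge0 yA yb]]] := @lp_duality _ _ A' b' c.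
- by exists x0; apply/feasibleP.
- by exists B => x /feasibleP; apply: Bc.
exists x, (fun i => y (inl (inl i))),
  (fun e => y (inr (inl e)) - y (inr (inr e))).
split; [exact/feasibleP| |].
  split=> [i|j]; first exact: y_ge0.
  rewrite -yA !big_sumType /= -addrA lerD2l.
  rewrite (eq_bigr (fun j' => - ((j' == j)%:R * y (inl (inr j'))))); last first.
    by move=> j' _; rewrite mulrN mulrC eq_sym.
  rewrite sumrN sum_delta -big_split /=.
  rewrite (eq_bigr (fun e => (y (inr (inl e)) - y (inr (inr e))) * D e j)).
    by rewrite gerDr oppr_le0.
  by move=> e _; rewrite mulrN -mulrBl.
move: yb; rewrite !big_sumType /= (big1 _ _ (fun j => y (inl (inr j)) * 0)).
  rewrite addr0 -big_split /= => /(le_trans _); apply.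
  by rewrite lerD2l; apply: ler_sum => e _; rewrite mulrN -mulrBl.
by move=> j _; rewrite mulr0.
Qed.

End MixedForm.
End LP.

(** * The restricted master problem as a linear program *)

Section RMP.
Local Open Scope fset_scope.
Local Open Scope ring_scope.
Variables (R : realType) (M : market R).
Implicit Types (C : columns M) (x : primal_sol M) (y : dual_sol M).

Section Encoding.
Variable C : columns M.

(** The position of a column records the zone as well, since the same vector may
    belong to the columns of several zones only as distinct variables. *)
Definition column := {l : zone M & C l}.
Definition rmp_variable : finType := (rdb M + gen M + column)%type.
Definition rmp_bound : finType := (rdb M + gen M + cne M)%type.

Definition rmp_bound_mx (i : rmp_bound) (j : rmp_variable) : R :=
  match i, j with
  | inl (inl r), inl (inl r') => (r' == r)%:R
  | inl (inr g), inl (inr g') => (g' == g)%:R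
  | inr k, inr c => Num.max 0 (flow k (val (tagged c)))
  | _, _ => 0
  end.

Definition rmp_bound_rhs (i : rmp_bound) : R :=
  match i with inl (inl r) => DR r | inl (inr g) => Pmax g | inr k => Fmax k end.

Definition rmp_balance_mx (z : zone M) (j : rmp_variable) : R :=
  match j with
  | inl (inl r) => (rdb_zone r == z)%:R
  | inl (inr g) => - (gen_zone g == z)%:R
  | inr c => val (tagged c) z
  end.

Definition rmp_value (j : rmp_variable) : R :=
  if j is inl (inl r) then VR r else 0.

Definition coords x (j : rmp_variable) : R :=
  match j with
  | inl (inl r) => dr x r
  | inl (inr g) => pr x g
  | inr c => fx x (tag c) (val (tagged c))
  end.

Definition multipliers y (i : rmp_bound) : R :=
  match i with inl (inl r) => sdr y r | inl (inr g) => splus y g | inr k => SP y k end.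

Notation rmp_lp := (lp_feasible rmp_bound_mx rmp_bound_rhs rmp_balance_mx (fun=> 0)).
Notation rmp_lp_dual := (lp_dual_feasible rmp_bound_mx rmp_balance_mx rmp_value).

Lemma sum_variable (F : rmp_variable -> R) :
  \sum_j F j = \sum_r F (inl (inl r)) + \sum_g F (inl (inr g))
               + \sum_l \sum_(v : C l) F (inr (Tagged (fun l => C l) v)).
Proof.
rewrite !big_sumType; congr (_ + _).
by rewrite (sig_big_dep xpredT (fun _ => xpredT)); apply: eq_bigr => -[].
Qed.

Lemma sum_support x l (G : vec M -> R) : finsupp (fx x l) `<=` C l ->
  \sum_(v <- finsupp (fx x l)) G v * fx x l v
    = \sum_(v : C l) G (val v) * fx x l (val v).
Proof.
move=> suppC; rewrite -(big_seq_fsetE _ _ xpredT (fun v => G v * fx x l v)).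
by apply: big_fset_incl => // v _ v0; rewrite fsfun_dflt // mulr0.
Qed.

Lemma sum_located (T : finType) (loc : T -> zone M) (F : T -> R) z :
  \sum_t (loc t == z)%:R * F t = \sum_(t | loc t == z) F t.
Proof.
rewrite [RHS]big_mkcond; apply: eq_bigr => t _.
by case: eqP; rewrite ?mul1r ?mul0r.
Qed.

(** The variables [nr] are eliminated through the netting equations, so that the
    balance constraints bear on [dr], [pr] and [fx] only. *)
Lemma rmp_feasibleP x :
  (forall l, finsupp (fx x l) `<=` C l) ->
  (forall z, nr x z = \sum_l \sum_(v <- finsupp (fx x l)) v z * fx x l v) ->
  rmp_feasible C x <-> rmp_lp (coords x).
Proof.
move=> suppC netting_x.
have capE k : \sum_j rmp_bound_mx (inr k) j * coords x j =
    \sum_l \sum_(v <- finsupp (fx x l)) Num.max 0 (flow k v) * fx x l v.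
  rewrite sum_variable /= [X in X + _ + _]big1 => [|r _]; rewrite ?mul0r //.
  rewrite [X in _ + X + _]big1 => [|g _]; rewrite ?mul0r // !add0r.
  by apply: eq_bigr => l _; rewrite sum_support.
have drE r : \sum_j rmp_bound_mx (inl (inl r)) j * coords x j = dr x r.
  rewrite sum_variable /= sum_delta [X in _ + X + _]big1 => [|g _]; rewrite ?mul0r //.
  by rewrite big1 ?addr0 // => l _; apply: big1 => v _; rewrite mul0r.
have prE g : \sum_j rmp_bound_mx (inl (inr g)) j * coords x j = pr x g.
  rewrite sum_variable /= sum_delta big1 => [|r _]; rewrite ?mul0r //.
  by rewrite add0r big1 ?addr0 // => l _; apply: big1 => v _; rewrite mul0r.
have balE z : \sum_j rmp_balance_mx z j * coords x j =
    \sum_(r | rdb_zone r == z) dr x r - \sum_(g | gen_zone g == z) pr x g + nr x z.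
  rewrite sum_variable /= sum_located netting_x; congr (_ + _ + _).
    rewrite -sum_located -sumrN; apply: eq_bigr => g _; exact: mulNr.
  by apply: eq_bigr => l _; rewrite sum_support.
split=> [xP|[x_ge0 xA xD]].
  split=> [[[r|g]|[l v]]|[[r|g]|k]|z] /=.
  - exact: dr_ge0 xP r.
  - exact: pr_ge0 xP g.
  - exact: fx_ge0 xP l _.
  - rewrite drE; exact: dr_le xP r.
  - rewrite prE; exact: pr_le xP g.
  - rewrite capE; exact: capacity xP k.
  - by rewrite balE (balance xP) addNr.
split=> // [l v /(fsubsetP (suppC l))//|r|g|z|k|r|g|l v].
- by have := xA (inl (inl r)); rewrite drE.
- by have := xA (inl (inr g)); rewrite prE.
- by have := xD z; rewrite balE => /eqP; rewrite addr_eq0 => /eqP.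
- by have := xA (inr k); rewrite capE.
- exact: (x_ge0 (inl (inl r))).
- exact: (x_ge0 (inl (inr g))).
- have [/(fsubsetP (suppC l)) vC|/fsfun_dflt-> //] := boolP (v \in finsupp (fx x l)).
  exact: (x_ge0 (inr (Tagged (fun l => C l) [` vC]))).
Qed.

(** Eliminating [nr] from the primal amounts to eliminating
    [pirnet] = - [pir] from the dual. *)
Lemma dual_feasibleP y : (forall z, pir y z + pirnet y z = 0) ->
  dual_feasible C y <-> rmp_lp_dual (multipliers y) (pir y).
Proof.
move=> nr_y; have pirnetE z : pirnet y z = - pir y z.
  by apply/eqP; rewrite -addr_eq0 addrC nr_y.
pose col j := \sum_i multipliers y i * rmp_bound_mx i j
  + \sum_z pir y z * rmp_balance_mx z j.
have pick (T : finType) (t0 : T) (F : T -> R) : \sum_t F t * (t0 == t)%:R = F t0.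
  by rewrite -[RHS](sum_delta t0); apply: eq_bigr => t _; rewrite mulrC eq_sym.
have sum0 (T : finType) (F : T -> R) : \sum_t F t * 0 = 0.
  by apply: big1 => t _; rewrite mulr0.
have drE r : col (inl (inl r)) = sdr y r + pir y (rdb_zone r).
  by rewrite /col !big_sumType /= !pick !sum0 !addr0.
have prE g : col (inl (inr g)) = splus y g - pir y (gen_zone g).
  rewrite /col !big_sumType /= pick !sum0 add0r addr0; congr (_ + _).
  rewrite -(pick _ (gen_zone g)) -sumrN.
  by apply: eq_bigr => z _; rewrite mulrN.
have fxE (c : column) : col (inr c) =
    - \sum_z pirnet y z * val (tagged c) z
    + \sum_k SP y k * Num.max 0 (flow k (val (tagged c))).
  rewrite /col !big_sumType /= !sum0 !add0r addrC; congr (_ + _); rewrite -sumrN.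
  by apply: eq_bigr => z _; rewrite pirnetE mulNr opprK.
split=> [yP|[y_ge0 yA]].
  split=> [[[r|g]|k]|[[r|g]|[l v]]]; rewrite -?/(col _).
  - exact: sdr_ge0 yP r.
  - exact: splus_ge0 yP g.
  - exact: SP_ge0 yP k.
  - rewrite drE; exact: dual_dr yP r.
  - rewrite prE; exact: dual_pr yP g.
  - rewrite fxE; exact: dual_fx yP _ _ (valP v).
split=> // [g|r|l v vC|g|r|k].
- by have := yA (inl (inr g)); rewrite -/(col _) prE.
- by have := yA (inl (inl r)); rewrite -/(col _) drE.
- have := yA (inr (Tagged (fun l => C l) [` vC])); by rewrite -/(col _) fxE.
- exact: (y_ge0 (inl (inr g))).
- exact: (y_ge0 (inl (inl r))).
- exact: (y_ge0 (inr k)).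
Qed.

Lemma primal_objectiveE x : primal_objective x = \sum_j rmp_value j * coords x j.
Proof.
rewrite sum_variable /= [X in _ + X + _]big1 => [|g _]; rewrite ?mul0r //.
by rewrite [X in _ + X]big1 ?addr0 // => l _; apply: big1 => v _; rewrite mul0r.
Qed.

Lemma dual_objectiveE y : dual_objective y =
  \sum_i multipliers y i * rmp_bound_rhs i + \sum_z pir y z * 0.
Proof.
rewrite [X in _ = _ + X]big1 => [|z _]; last by rewrite mulr0.
rewrite addr0 !big_sumType /dual_objective /=.
by congr (_ + _ + _); apply: eq_bigr => ? _; rewrite mulrC.
Qed.

Lemma rmp_weak_duality x y :
  rmp_feasible C x -> dual_feasible C y -> primal_objective x <= dual_objective y.
Proof.
move=> xP yP; rewrite primal_objectiveE dual_objectiveE.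
apply: lp_weak_duality.
  apply/rmp_feasibleP => //; last exact: netting xP.
  by move=> l; apply/fsubsetP => v; apply: fx_supp xP _ _.
by apply/dual_feasibleP => //; apply: dual_nr yP.
Qed.

Definition primal_of (w : rmp_variable -> R) : primal_sol M :=
  let f l : {fsfun vec M -> R with 0} :=
    [fsfun v : C l => w (inr (Tagged (fun l => C l) v))] in
  Primal [ffun r => w (inl (inl r))] [ffun g => w (inl (inr g))]
    [ffun z => \sum_l \sum_(v <- finsupp (f l)) v z * f l v] f.

Definition dual_of (m : rmp_bound -> R) (u : zone M -> R) : dual_sol M :=
  Dual [ffun r => m (inl (inl r))] [ffun g => m (inl (inr g))]
    [ffun z => u z] [ffun z => - u z] [ffun k => m (inr k)].

Lemma coords_primal_of w : coords (primal_of w) = w.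
Proof.
by apply/funext => -[[r|g]|[l v]] /=; rewrite ?ffunE // fsfun_ffun valK.
Qed.

Lemma multipliers_dual_of m u : multipliers (dual_of m u) = m.
Proof. by apply/funext => -[[r|g]|k] /=; rewrite ffunE. Qed.

(** The objective is bounded because 0 <= [dr r] <= [DR r]. *)
Lemma rmp_strong_duality : (exists x, rmp_feasible C x) ->
  exists x y, [/\ rmp_feasible C x, dual_feasible C y
                & dual_objective y <= primal_objective x].
Proof.
move=> [x0 x0P].
have [||w [m [u [wP muP le_obj]]]] :=
    @lp_strong_duality _ _ _ _ rmp_bound_mx rmp_bound_rhs rmp_balance_mx
      (fun=> 0) rmp_value.
- exists (coords x0); apply/rmp_feasibleP => //; last exact: netting x0P.
  by move=> l; apply/fsubsetP => v; apply: fx_supp x0P _ _.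
- exists (\sum_(r : rdb M) `|VR r| * DR r) => w wP; have [w_ge0 wA _] := wP.
  have <- := coords_primal_of w; rewrite -primal_objectiveE.
  apply: ler_sum => r _; rewrite ffunE.
  have := w_ge0 (inl (inl r)); have := wA (inl (inl r)).
  rewrite sum_variable /= sum_delta [X in _ + X + _]big1 => [|g _]; rewrite ?mul0r //.
  rewrite [X in _ + X]big1 => [|l _]; last by apply: big1 => v _; rewrite mul0r.
  rewrite !addr0 => w_le w_ge; apply: le_trans (ler_wpM2l (normr_ge0 _) w_le).
  by apply: ler_wpM2r => //; apply: ler_norm.
have uE : pir (dual_of m u) = u :> (_ -> _) by apply/funext => z; rewrite ffunE.
exists (primal_of w), (dual_of m u); split.
- apply/rmp_feasibleP => [l|z|].
  + exact: finsupp_sub.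
  + by rewrite ffunE.
  + by rewrite coords_primal_of.
- apply/dual_feasibleP => [z|]; first by rewrite !ffunE addrN.
  by rewrite multipliers_dual_of uE.
- by rewrite primal_objectiveE dual_objectiveE coords_primal_of
    multipliers_dual_of uE.
Qed.

End Encoding.

Lemma rmp_solvable C : (exists x, rmp_feasible C x) ->
  exists x y, rmp_solved C x y.
Proof.
move=> /rmp_strong_duality[x [y [xP yP le_yx]]]; exists x, y; split; split=> //.
  by move=> x' x'P; apply: le_trans le_yx; apply: (@rmp_weak_duality C).
by move=> y' y'P; apply: le_trans le_yx _; apply: (@rmp_weak_duality C).
Qed.

Lemma rmp_solved_objective C x y : rmp_solved C x y ->
  dual_objective y <= primal_objective x.
Proof.
move=> [[xP xmax] [yP ymin]].
have [|x0 [y0 [x0P y0P le0]]] := @rmp_strong_duality C; first by exists x.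
by apply: le_trans (ymin _ y0P) (le_trans le0 (xmax _ x0P)).
Qed.

End RMP.

(** * Pricing problems *)

Section Pricing.
Local Open Scope fset_scope.
Local Open Scope ring_scope.
Variables (R : realType) (M : market R).
Implicit Types (l z : zone M) (k : cne M) (p q : pricing_point M).
Implicit Types (pn : {ffun zone M -> R}) (sp : {ffun cne M -> R}).

Definition pricing_bound_mx k (j : zone M + cne M) : R :=
  match j with inl z => PTDF k z | inr k' => - (k' == k)%:R end.

(** The coordinates are [t] and v + e_l, all of them nonnegative; the two
    equations say that v + e_l sums to 1 and vanishes at [l]. *)
Definition pricing_eq_mx l (e : bool) (j : zone M + cne M) : R :=
  if j is inl z then (if e then 1 else (z == l)%:R) else 0.

Definition pricing_value pn sp (j : zone M + cne M) : R :=
  match j with inl z => pn z | inr k => - sp k end.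

Notation pricing_lp l :=
  (lp_feasible pricing_bound_mx (fun k => PTDF k l) (pricing_eq_mx l) (fun e => e%:R)).

Definition pricing_coords l p (j : zone M + cne M) : R :=
  match j with inl z => p.1 z + (z == l)%:R | inr k => p.2 k end.

Lemma sum_pricing_coords l p (G : zone M -> R) :
  \sum_z G z * (p.1 z + (z == l)%:R) = \sum_z G z * p.1 z + G l.
Proof.
under eq_bigr do rewrite mulrDr.
rewrite big_split /=; congr (_ + _); rewrite -[RHS](sum_delta l).
by apply: eq_bigr => z _; rewrite mulrC.
Qed.

Lemma pricing_feasibleP l p :
  pricing_feasible l p <-> pricing_lp l (pricing_coords l p).
Proof.
have flowE k : \sum_j pricing_bound_mx k j * pricing_coords l p j =
    flow k p.1 + PTDF k l - p.2 k.
  rewrite big_sumType /= sum_pricing_coords; congr (_ + _).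
  rewrite -[p.2 k](sum_delta k) -sumrN.
  by apply: eq_bigr => k' _; rewrite mulNr.
have totalE : \sum_j pricing_eq_mx l true j * pricing_coords l p j =
    \sum_z p.1 z + 1.
  rewrite big_sumType /= sum_pricing_coords [X in _ + X]big1 => [|k _].
    by rewrite addr0; congr (_ + _); apply: eq_bigr => z _; rewrite mul1r.
  by rewrite mul0r.
have sourceE : \sum_j pricing_eq_mx l false j * pricing_coords l p j = p.1 l + 1.
  rewrite big_sumType /= sum_delta eqxx big1 ?addr0 // => k _.
  by rewrite mul0r.
split=> [[le_t t_ge0 [vl v_ge0 v0]]|[x_ge0 xA xD]].
  split=> [[z|k]|k|[]] /=.
  - have [->|zl] := eqVneq z l; first by rewrite vl addNr.
    by rewrite addr0 v_ge0.
  - exact: t_ge0.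
  - by rewrite flowE; have := le_t k; lra.
  - by rewrite totalE v0 add0r.
  - by rewrite sourceE vl addNr.
split=> [k|k|].
- by have := xA k; rewrite flowE; lra.
- exact: (x_ge0 (inr k)).
split=> [|z zl|].
- by have := xD false; rewrite sourceE => /eqP; rewrite addr_eq0 => /eqP.
- by have := x_ge0 (inl z); rewrite /= (negbTE zl) addr0.
- by have := xD true; rewrite totalE => /(canRL (addrK _)); rewrite subrr.
Qed.

Lemma pricing_objectiveE l pn sp p : pricing_objective pn sp p =
  pn l - \sum_j pricing_value pn sp j * pricing_coords l p j.
Proof.
rewrite big_sumType /= sum_pricing_coords /pricing_objective.
have -> : \sum_k - sp k * p.2 k = - \sum_k sp k * p.2 k.
  by rewrite -sumrN; apply: eq_bigr => k _; rewrite mulNr.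
by lra.
Qed.

Definition pricing_of l (w : zone M + cne M -> R) : pricing_point M :=
  ([ffun z => w (inl z) - (z == l)%:R], [ffun k => w (inr k)]).

Lemma pricing_coordsK l w : pricing_coords l (pricing_of l w) = w.
Proof. by apply/funext => -[z|k]; rewrite /= ffunE ?subrK. Qed.

(** The completion of [v] with the smallest feasible [t], which is the cheapest
    one for nonnegative prices. *)
Definition tight_point (v : vec M) : pricing_point M :=
  (v, [ffun k => Num.max 0 (flow k v)]).

Lemma tight_point_feasible l (v : vec M) :
  exchange_set l v -> pricing_feasible l (tight_point v).
Proof. by split=> // k; rewrite ffunE le_max lexx ?orbT. Qed.

(** The minimum is attained because the coordinates v + e_l lie in a simplex and
    the cost of [t] is nonnegative. *)
Lemma pricing_attained l pn sp (v : vec M) :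
  (forall k, 0 <= sp k) -> exchange_set l v -> exists p, pricing_optimal l pn sp p.
Proof.
move=> sp_ge0 vP.
have [||w [m [u [wP muP le_obj]]]] := @lp_strong_duality _ _ _ _
    pricing_bound_mx (fun k => PTDF k l) (pricing_eq_mx l) (fun e => e%:R)
    (pricing_value pn sp).
- exists (pricing_coords l (tight_point v)).
  exact/pricing_feasibleP/tight_point_feasible.
- exists (\sum_z `|pn z|) => w [w_ge0 _ wD].
  have w_total : \sum_z w (inl z) = 1.
    have := wD true; rewrite big_sumType /= [X in _ + X]big1 => [|k _].
      by rewrite addr0 => /(etrans _); apply; apply: eq_bigr => z _; rewrite mul1r.
    by rewrite mul0r.
  rewrite big_sumType /= -[leRHS]addr0; apply: lerD; last first.
    by apply: sumr_le0 => k _; rewrite mulNr oppr_le0 mulr_ge0.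
  apply: ler_sum => z _; apply: le_trans (ler_norm _) _.
  rewrite normrM ler_piMr // ger0_norm // -w_total (bigD1 z) //=.
  by rewrite lerDl sumr_ge0.
exists (pricing_of l w); split.
  by apply/pricing_feasibleP; rewrite pricing_coordsK.
move=> p /pricing_feasibleP pP.
rewrite !(pricing_objectiveE l) pricing_coordsK lerB //.
exact: le_trans (lp_weak_duality pP muP) le_obj.
Qed.

(** * Finiteness of the set of vertices *)

(** The constraint [v z >= 0] does not concern [z = l]; a constant slack 0 there
    makes that index harmless. *)
Definition slack l p (i : cne M + cne M + zone M) : R :=
  match i with
  | inl (inl k) => p.2 k - flow k p.1
  | inl (inr k) => p.2 k
  | inr z => if z == l then 0 else p.1 z
  end.

Lemma pricing_feasible_slack l p : pricing_feasible l p <->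
  [/\ forall i, 0 <= slack l p i, p.1 l = -1 & \sum_z p.1 z = 0].
Proof.
split=> [[le_t t_ge0 [vl v_ge0 v0]]|[s_ge0 vl v0]].
  split=> // -[[k|k]|z] /=; rewrite ?subr_ge0 //.
  by case: eqVneq => // /v_ge0.
split=> [k|k|].
- by have := s_ge0 (inl (inl k)); rewrite /= subr_ge0.
- exact: (s_ge0 (inl (inr k))).
- split=> // z zl.
  by have := s_ge0 (inr z); rewrite /= (negbTE zl).
Qed.

(** The point p + s (q - p); negative [s] is allowed, and gives a point beyond
    [p] on the line through [q]. *)
Definition mix (s : R) p q : pricing_point M :=
  ([ffun z => p.1 z + s * (q.1 z - p.1 z)], [ffun k => p.2 k + s * (q.2 k - p.2 k)]).

Lemma sum_mix s p q (G : zone M -> R) :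
  \sum_z G z * (mix s p q).1 z =
  \sum_z G z * p.1 z + s * (\sum_z G z * q.1 z - \sum_z G z * p.1 z).
Proof.
rewrite -sumrB mulr_sumr -big_split; apply: eq_bigr => z _.
by rewrite /= ffunE; lra.
Qed.

Lemma slack_mix l s p q i :
  slack l (mix s p q) i = slack l p i + s * (slack l q i - slack l p i).
Proof.
case: i => [[k|k]|z] /=; rewrite ?ffunE //.
  by rewrite /flow sum_mix; lra.
by case: eqP => // _; lra.
Qed.

Lemma mix_feasible l s p q : pricing_feasible l p -> pricing_feasible l q ->
  (forall i, s * (slack l p i - slack l q i) <= slack l p i) ->
  pricing_feasible l (mix s p q).
Proof.
move=> /pricing_feasible_slack[_ pl p0] /pricing_feasible_slack[_ ql q0] sP.
apply/pricing_feasible_slack; split=> [i||].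
- by rewrite slack_mix; have := sP i; lra.
- by rewrite ffunE pl ql subrr mulr0 addr0.
- have total (v : vec M) : \sum_z 1 * v z = \sum_z v z.
    by apply: eq_bigr => z _; rewrite mul1r.
  by have := sum_mix s p q (fun=> 1); rewrite !total p0 q0 => ->; lra.
Qed.

(** Slacks [s] that decrease at the rates [d] all stay nonnegative for a while,
    provided that those which are 0 do not decrease. *)
Lemma small_step (I : finType) (s d : I -> R) :
  (forall i, 0 <= s i) -> (forall i, s i = 0 -> d i <= 0) ->
  exists2 e, 0 < e <= 1 & forall i, e * d i <= s i.
Proof.
move=> s_ge0 s0; pose T := 1 + \sum_i `|d i| / s i.
have T_ge1 : 1 <= T by rewrite lerDl sumr_ge0 // => i _; rewrite divr_ge0.
have T_gt0 : 0 < T by lra.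
(* T bounds all the ratios d i / s i with s i > 0; if s i = 0 the ratio is 0. *)
exists T^-1; first by rewrite invr_gt0 T_gt0 invf_le1.
move=> i; rewrite ler_pdivrMl //.
have := s_ge0 i; rewrite le_eqVlt => /orP[/eqP si|si].
  by rewrite -si mulr0 s0.
apply: le_trans (ler_norm _) _; rewrite -ler_pdivrMr // /T (bigD1 i) //=.
rewrite addrCA lerDl addr_ge0 // sumr_ge0 // => j _.
by rewrite divr_ge0.
Qed.

(** If [q] satisfies with equality the constraints that are tight at [p], the
    line through [p] and [q] remains feasible for a while beyond [p]; then [p]
    is the midpoint of a feasible segment, which has to be trivial. *)
Lemma vertex_determined l p q :
  pricing_vertex l p -> pricing_feasible l q ->
  (forall i, slack l p i = 0 -> slack l q i = 0) -> p = q.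
Proof.
move=> [pP extreme] qP tight.
have [sp _ _] := (pricing_feasible_slack l p).1 pP.
have [sq _ _] := (pricing_feasible_slack l q).1 qP.
have [|e /andP[e_gt0 e_le1] eP] :=
    @small_step _ (slack l p) (fun i => slack l q i - slack l p i) sp.
  by move=> i pi; rewrite (tight i pi) pi subrr.
have aP : pricing_feasible l (mix e p q).
  apply: mix_feasible => // i.
  have := sq i; have := sp i; nra.
have bP : pricing_feasible l (mix (- e) p q).
  by apply: mix_feasible => // i; have := eP i; lra.
have half : 0 < (2^-1 : R) < 1 by apply/andP; split; lra.
have cancel (a b : R) : a + e * (b - a) = a + - e * (b - a) -> a = b.
  move=> eq_ab; have /eqP : e * (b - a) = 0 by lra.
  by rewrite mulf_eq0 gt_eqF //= subr_eq0 eq_sym => /eqP.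
have eq_ab : mix e p q = mix (- e) p q.
  by apply: extreme aP bP half _ _ => [z|k]; rewrite !ffunE; lra.
rewrite [p]surjective_pairing [q]surjective_pairing; congr (_, _).
  apply/ffunP => z; apply: cancel.
  by have /ffunP/(_ z) := congr1 fst eq_ab; rewrite !ffunE.
apply/ffunP => k; apply: cancel.
by have /ffunP/(_ k) := congr1 snd eq_ab; rewrite !ffunE.
Qed.
End Pricing.

(** * The algorithm *)

Section Algorithm.
Local Open Scope fset_scope.
Local Open Scope ring_scope.
Variables (R : realType) (M : market R) (price : pricing_method M).
Implicit Types (C : columns M) (x : primal_sol M) (y : dual_sol M).

Lemma ibbe_exchange l (v : vec M) : v \in ibbe M l -> exchange_set l v.
Proof.
move=> /imfsetP[n /= nl ->]; have {}nl : n != l := nl.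
split=> [|z zl|].
- by rewrite !ffunE eqxx eq_sym (negbTE nl) sub0r.
- by rewrite !ffunE (negbTE zl) subr0 ler0n.
- under eq_bigr do rewrite !ffunE.
  have one j : \sum_(z : zone M) (z == j)%:R = 1 :> R.
    by rewrite -[RHS](sum_delta j (fun=> 1)); apply: eq_bigr => z _; rewrite mulr1.
  by rewrite sumrB !one subrr.
Qed.

Lemma adds_columns_grow y C C' l :
  adds_columns price y C C' -> C l `<=` C' l.
Proof.
move=> [_ /(_ l)[new old]].
have [/new[p [_ ->]]|/old-> //] := pselect (negative_price y l).
exact: fsubsetU1.
Qed.

Lemma reached_sub C l : reached price C -> ibbe M l `<=` C l.
Proof.
elim=> {C}[|C C' _ sub [x [y [_ addC]]]]; first exact: fsubset_refl.
exact: fsubset_trans sub (adds_columns_grow l addC).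
Qed.

Lemma reached_exchange C l (v : vec M) :
  returns_optimal_vertex price -> reached price C -> v \in C l ->
  exchange_set l v.
Proof.
move=> price_vertex reachC.
elim: reachC v => {C}[|C C' _ IH [x [y [_ [_ /(_ l)[new old]]]]]] v.
  exact: ibbe_exchange.
have [/new[p [/(price_vertex l _ _).2[[[_ _ pl] _] _] ->]]|/old->] :=
  pselect (negative_price y l); last exact: IH.
by rewrite in_fset1U => /orP[/eqP->|/IH].
Qed.

Lemma feasible_sub C C' x : (forall l, C l `<=` C' l) ->
  rmp_feasible C x -> rmp_feasible C' x.
Proof. by move=> sub [s *]; split=> // l v /s /(fsubsetP (sub l)). Qed.

(** For a vector that is already a column, the dual constraint bounds the price
    from below by 0, since [t] dominates the positive part of the flow. *)
Lemma new_column C y l p : dual_feasible C y ->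
  pricing_feasible l p -> pricing_objective (pirnet y) (SP y) p < 0 ->
  p.1 \notin C l.
Proof.
move=> yP [le_t t_ge0 _]; rewrite ltNge; apply: contra => pC.
apply: le_trans (dual_fx yP pC) _; rewrite lerD2l; apply: ler_sum => k _.
by apply: ler_wpM2l; [exact: SP_ge0 yP k | rewrite ge_max t_ge0 le_t].
Qed.

Lemma next_rmp_new C C' :
  returns_optimal_vertex price -> next_rmp price C C' ->
  exists l p, [/\ pricing_vertex l p, p.1 \notin C l & p.1 \in C' l].
Proof.
move=> price_vertex [x [y [[_ [yP _]] [[l negl] /(_ l)[/(_ negl)[p [pp C'E]] _]]]]].
have [[pF pmin] pv] := (price_vertex l _ _).2 _ pp.
have [q [[qF _] q_neg]] := negl.
exists l, p; split=> //; last by rewrite C'E fset1U1.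
by apply: new_column yP pF _; apply: le_lt_trans q_neg; apply: pmin.
Qed.

(** Pigeonhole on the pairs formed of a zone and the tight set of the vertex added
    for it. *)
Lemma no_infinite_run (Cs : nat -> columns M) :
  returns_optimal_vertex price ->
  ~ (forall i, next_rmp price (Cs i) (Cs i.+1)).
Proof.
move=> price_vertex run.
have grow i j l : (i <= j)%N -> Cs i l `<=` Cs j l.
  elim: j => [|j IH]; first by rewrite leqn0 => /eqP->.
  rewrite leq_eqVlt => /predU1P[->//|/IH/fsubset_trans]; apply.
  by have [x [y [_ addC]]] := run j; apply: adds_columns_grow addC.
have /choice[lp lpP] : forall i, exists lp : zone M * pricing_point M,
    [/\ pricing_vertex lp.1 lp.2, lp.2.1 \notin Cs i lp.1
      & lp.2.1 \in Cs i.+1 lp.1].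
  by move=> i; have [l [p lpP]] := next_rmp_new price_vertex (run i); exists (l, p).
pose T : finType := (zone M * {set cne M + cne M + zone M})%type.
pose tight i : T := ((lp i).1, [set c | slack (lp i).1 (lp i).2 c == 0]).
have fresh i j : (i < j)%N -> tight i <> tight j.
  move=> lt_ij [eq_l /setP eq_tight].
  have [[viF _ ] _ in_i] := lpP i; have [vj + _] := lpP j.
  rewrite eq_l in viF in_i eq_tight; have [vjF _] := vj.
  have -> : (lp j).2 = (lp i).2.
    apply: vertex_determined vj viF _ => c cj.
    by apply/eqP; have := eq_tight c; rewrite !inE cj eqxx.
  by rewrite (fsubsetP (grow _ _ _ lt_ij) _ in_i).
have : injective (fun i : 'I_#|T|.+1 => tight i).
  move=> i j eq_ij; apply: val_inj; apply/eqP.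
  by case: ltngtP => // /fresh; rewrite /= eq_ij.
by move/leq_card; rewrite card_ord ltnn.
Qed.

(** When [v] is an exchange, the pricing problem is feasible, hence has an optimal
    solution; its value is nonnegative because the algorithm stops, and at most
    the price of [v] with the smallest [t]. *)
Lemma stops_dual_feasible C C' y : dual_feasible C y -> stops y ->
  (forall l (v : vec M), v \in C' l -> exchange_set l v) -> dual_feasible C' y.
Proof.
move=> yP stop exC'.
split; [exact: dual_pr yP|exact: dual_dr yP|exact: dual_nr yP| |
        exact: splus_ge0 yP|exact: sdr_ge0 yP|exact: SP_ge0 yP].
move=> l v /exC' vP; have [p pP] := pricing_attained (pirnet y) (SP_ge0 yP) vP.
have p_ge0 : 0 <= pricing_objective (pirnet y) (SP y) p.
  by rewrite leNgt; apply/negP => p_lt0; apply: (stop l); exists p.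
apply: le_trans p_ge0 (le_trans (pP.2 _ (tight_point_feasible vP)) _).
by rewrite /pricing_objective lerD2l; apply: ler_sum => k _; rewrite ffunE.
Qed.

(** A competitor of the full problem is compared with the dual solution in the
    restricted problem whose columns are the support of the competitor. *)
Lemma returned_optimal C x :
  (forall l (v : vec M), v \in C l -> exchange_set l v) ->
  returned C x -> ibme_optimal x.
Proof.
move=> exC [y [xy stop]]; have [[xP _] [yP _]] := xy.
split=> [|x' x'P].
  by move: xP => [s *]; split=> // l v /s /exC.
pose C' l := finsupp (fx x' l).
apply: le_trans (rmp_solved_objective xy); apply: (@rmp_weak_duality _ _ C').
  by case: x'P => *; split.
by apply: stops_dual_feasible yP stop _ => l v /(fx_supp x'P).
Qed.

(** A pricing problem with negative value has an optimal solution by definition,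
    so that the method answers it. *)
Lemma columns_added C y : returns_optimal_vertex price ->
  stops y \/ exists C', adds_columns price y C C'.
Proof.
move=> price_vertex.
have [stop|/existsNP[l /contrapT negl]] := pselect (stops y); [by left|right].
have /choice[C' C'P] : forall l, exists Cl : {fset vec M},
    (negative_price y l ->
       exists p, price l (pirnet y) (SP y) p /\ Cl = p.1 |` C l) /\
    (~ negative_price y l -> Cl = C l).
  move=> l'; have [neg|pos] := pselect (negative_price y l'); last by exists (C l').
  have [q [qP _]] := neg.
  have [p pp] := (price_vertex l' _ _).1 (ex_intro _ q qP).
  by exists (p.1 |` C l'); split=> // _; exists p.
by exists C'; split; first by exists l.
Qed.
End Algorithm.

Theorem mainTheorem6 (R : realType) (M : market R) (price : pricing_method M)
    (ibbe_feasible : exists x : primal_sol M, rmp_feasible (ibbe M) x)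
    (price_vertex : returns_optimal_vertex price) :
  (* every iteration can be carried out, whichever optimal solutions are
     obtained for the current restricted master problem *)
  (forall C : columns M, reached price C ->
     (exists (x : primal_sol M) (y : dual_sol M), rmp_solved C x y) /\
     (forall (x : primal_sol M) (y : dual_sol M), rmp_solved C x y ->
        stops y \/ exists C' : columns M, adds_columns price y C C')) /\
  (* there is no infinite run *)
  (~ exists Cs : nat -> columns M,
       Cs 0 = ibbe M /\ forall i : nat, next_rmp price (Cs i) (Cs i.+1)) /\
  (* the solution returned upon termination is optimal for IBME *)
  (forall (C : columns M) (x : primal_sol M),
     reached price C -> returned C x -> ibme_optimal x).
Proof.
split=> [C reachC|]; first split=> [|x y _].
- apply: rmp_solvable; have [x xP] := ibbe_feasible; exists x.
  by apply: feasible_sub xP => l; apply: reached_sub reachC.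
- exact: columns_added.
split=> [[Cs [_ run]]|C x reachC]; first exact: no_infinite_run price_vertex run.
by apply: returned_optimal => l v; apply: reached_exchange price_vertex reachC.
Qed.
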